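(* Let $\mathbb{K}$ be an algebraically closed field with a non-archimedean valuation $\nu:\mathbb{K}\to\mathbb{R}\cup\{+\infty\}$. Let $\mathcal{A}=(\mathcal{A}_{ij})\in\mathbb{K}^{n\times n}$. Then the sequence of valuations of the eigenvalues of $\mathcal{A}$ (counted with multiplicities) is weakly (super) majorized by the sequence of min-plus algebraic eigenvalues of the matrix $A:=(\nu(\mathcal{A}_{ij}))\in\mathbb{R}_{\min}^{n\times n}$.
   Context: A non-archimedean valuation on a field $\mathbb{K}$ is a map $\nu:\mathbb{K}\to\mathbb{R}\cup\{+\infty\}$ with $\nu(a)=+\infty\iff a=0$, $\nu(a+b)\ge\min(\nu(a),\nu(b))$, $\nu(ab)=\nu(a)+\nu(b)$. $\mathbb{R}_{\min}=\mathbb{R}\cup\{+\infty\}$ is the min-plus semifield, with addition $a\oplus b=\min(a,b)$, multiplication $ab=a+b$ (usual sum), zero element $+\infty$ and unit element $0$. A formal polynomial $P=\bigoplus_{k=0}^n P_k\mathsf{Y}^k$ of degree $n$ over $\mathbb{R}_{\min}$ (so $P_n\ne+\infty$) has associated polynomial function $\widehat P(y)=\min_k(P_k+ky)$, $y\in\mathbb{R}_{\min}$ (the term $k=0$ being $P_0$). It factors uniquely as $\widehat P(y)=P_n+\sum_{i=1}^n\min(y,c_i)$ with $c_1\le\cdots\le c_n$ in $\mathbb{R}_{\min}$; the $c_i$ are the (min-plus) roots of $P$. For $A\in\mathbb{R}_{\min}^{n\times n}$, the min-plus characteristic polynomial is $P_A=\bigoplus_{k=0}^n (P_A)_k\mathsf{Y}^k$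 with $(P_A)_n=0$ and, for $0\le k\le n-1$, $(P_A)_k=\min_{J\subset[n],\,\#J=n-k}\ \min_{\sigma\in\mathfrak{S}_J}\sum_{j\in J}A_{j\sigma(j)}$, where $[n]=\{1,\dots,n\}$ and $\mathfrak{S}_J$ is the set of permutations of $J$. The min-plus algebraic eigenvalues of $A$ are the $n$ roots of $P_A$. For $u,v\in\mathbb{R}_{\min}^n$ with increasingly ordered entries $u_{(1)}\le\cdots\le u_{(n)}$ and $v_{(1)}\le\cdots\le v_{(n)}$, $u$ is weakly (super) majorized by $v$, written $u\prec^{\rm w}v$, if $u_{(1)}+\cdots+u_{(k)}\ge v_{(1)}+\cdots+v_{(k)}$ for all $k=1,\dots,n$ (usual sums in $\mathbb{R}\cup\{+\infty\}$). *)

(* Defs.v *)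
From HB Require Import structures.
From mathcomp Require Import all_boot all_order all_algebra all_fingroup.
From mathcomp Require Import reals constructive_ereal.

Set Implicit Arguments.
Unset Strict Implicit.
Unset Printing Implicit Defensive.

Import Order.TTheory GRing.Theory Num.Theory.
Local Open Scope ring_scope.
Local Open Scope ereal_scope.

(* The min-plus semifield R u {+oo} is represented inside \bar R by the
   elements distinct from -oo.  On those, the addition of \bar R is the usual
   sum (the min-plus product), and [x *+ k] is k x, with [x *+ 0] = 0 even when
   x = +oo. *)
Definition in_Rmin (R : realType) (x : \bar R) : bool := x != -oo.

Record is_valuation (K : fieldType) (R : realType) (nu : K -> \bar R) : Prop :=
  IsValuation {
    valuation_Rmin : forall a, in_Rmin (nu a);
    valuation_eqy : forall a, nu a = +oo <-> a = 0%R;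
    valuationD : forall a b, mine (nu a) (nu b) <= nu (a + b)%R;
    valuationM : forall a b, nu (a * b)%R = nu a + nu b
  }.

(* Formal min-plus polynomials of degree n are given by their coefficients. *)
Definition mp_eval (R : realType) (n : nat) (P : 'I_n.+1 -> \bar R)
    (y : \bar R) : \bar R :=
  \big[mine/+oo]_(k < n.+1) (P k + y *+ k).

(* c is the sequence of the n roots of P: the unique nondecreasing sequence
   in R u {+oo} that factors the polynomial function of P. *)
Definition mp_roots (R : realType) (n : nat) (P : 'I_n.+1 -> \bar R)
    (c : n.-tuple (\bar R)) : Prop :=
  [/\ P ord_max != +oo,
      all (@in_Rmin R) c,
      sorted <=%O c &
      forall y : \bar R, in_Rmin y ->
        mp_eval P y = P ord_max + \sum_(i < n) mine y (tnth c i)].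

(* Permutations of J are represented by the permutations of 'I_n that fix
   every point outside J. *)
Definition mp_char_poly (R : realType) (n : nat) (A : 'M[\bar R]_n)
    (k : 'I_n.+1) : \bar R :=
  if k == ord_max then 0 else
  \big[mine/+oo]_(J : {set 'I_n} | #|J| == (n - k)%N)
    \big[mine/+oo]_(s : {perm 'I_n} | perm_on J s)
      \sum_(j in J) A j (s j).

Definition mp_alg_eigenvalues (R : realType) (n : nat) (A : 'M[\bar R]_n)
    (c : n.-tuple (\bar R)) : Prop :=
  mp_roots (mp_char_poly A) c.

Definition weakly_super_majorized (R : realType) (n : nat)
    (u v : n.-tuple (\bar R)) : Prop :=
  forall k : nat, (1 <= k <= n)%N ->
    \sum_(x <- take k (sort <=%O v)) x <= \sum_(x <- take k (sort <=%O u)) x.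

(* The eigenvalues of A, counted with algebraic multiplicity. *)
Definition eigenvalues_mult (K : closedFieldType) (n : nat) (A : 'M[K]_n)
    (l : n.-tuple K) : Prop :=
  char_poly A = (\prod_(x <- l) ('X - x%:P))%R.

(* Main.v *)
Require Import Defs.
From HB Require Import structures.
From mathcomp Require Import all_boot all_order all_algebra all_fingroup.
From mathcomp Require Import reals constructive_ereal.

(** The determinant expansion gives nu of the k-th coefficient of the
    characteristic polynomial at least (P_A)_k, and the Newton polygon of
    prod_i (X - l_i) at slope y is attained at some index with value
    sum_i min(y, nu(l_i)).  Hence sum_i min(y, c_i) <= sum_i min(y, nu(l_i)) for
    every real y.  If c_k is finite, y = c_k makes the left side
    c_1 + ... + c_k + (n - k) c_k, while the right side is at most the sum of any
    k of the valuations plus (n - k) c_k; if c_k is infinite, y = M with M -> +oo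
    replaces it. *)

Import Order.TTheory GRing.Theory Num.Theory.
Local Open Scope ring_scope.
Local Open Scope ereal_scope.

(** * Ultrametric arithmetic, Newton polygons and the coefficients of the characteristic
    polynomial *)

Section Valuation.
Set Implicit Arguments.
Unset Strict Implicit.
Context {R : realType} {K : fieldType} {nu : K -> \bar R}.
Hypothesis hnu : is_valuation nu.

Lemma valuation0 : nu 0%R = +oo.
Proof. exact/(valuation_eqy hnu). Qed.

Lemma valuation_neqNy a : nu a != -oo.
Proof. exact: valuation_Rmin hnu a. Qed.

Lemma valuation_fin a : a != 0%R -> nu a \is a fin_num.
Proof.
move=> /eqP a0; rewrite fin_numE valuation_neqNy /=.
by apply/eqP => /(valuation_eqy hnu).
Qed.

Lemma valuation1 : nu 1%R = 0.
Proof.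
have := valuation_fin (oner_neq0 K).
have := valuationM hnu 1%R 1%R; rewrite mulr1.
case: (nu 1%R) => // r /eqP.
by rewrite -EFinD eqe -[X in X == _]addr0 (inj_eq (addrI r)) => /eqP <-.
Qed.

Lemma valuationN a : nu (- a)%R = nu a.
Proof.
have nuN1 : nu (- 1)%R = 0.
  have : (- 1 != 0 :> K)%R by rewrite oppr_eq0 oner_eq0.
  move=> /valuation_fin; have := valuationM hnu (-1)%R (-1)%R.
  rewrite mulrNN mulr1 valuation1; case: (nu (-1)%R) => // r /esym/eqP.
  by rewrite -EFinD eqe -mulr2n mulrn_eq0 /= => /eqP ->.
by rewrite -mulN1r (valuationM hnu) nuN1 add0e.
Qed.

Lemma valuation_ge_add m a b : m <= nu a -> m <= nu b -> m <= nu (a + b)%R.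
Proof.
by move=> ma mb; apply: le_trans (valuationD hnu a b); rewrite le_min ma.
Qed.

Lemma valuation_gt_add m a b : m < nu a -> m < nu b -> m < nu (a + b)%R.
Proof.
by move=> ma mb; apply: lt_le_trans (valuationD hnu a b); rewrite lt_min ma.
Qed.

(** If the sum had valuation greater than [nu a], so would [a = (a + b) - b]. *)
Lemma valuation_eq_add a b : nu a < nu b -> nu (a + b)%R = nu a.
Proof.
move=> ab; apply/eqP; rewrite eq_le (valuation_ge_add (lexx _) (ltW ab)) andbT.
rewrite leNgt; apply/negP => lt_a.
have : nu a < nu (a + b - b)%R by apply: valuation_gt_add; rewrite ?valuationN.
by rewrite addrK ltxx.
Qed.

Lemma valuation_ge_sum I (r : seq I) (P : pred I) (F : I -> K) m :
  (forall i, P i -> m <= nu (F i)) -> m <= nu (\sum_(i <- r | P i) F i)%R.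
Proof.
move=> mF; apply: (big_ind (fun a => m <= nu a)) => //.
  by rewrite valuation0 leey.
exact: valuation_ge_add.
Qed.

Lemma valuation_prod I (r : seq I) (P : pred I) (F : I -> K) :
  nu (\prod_(i <- r | P i) F i)%R = \sum_(i <- r | P i) nu (F i).
Proof. exact: (big_morph nu (valuationM hnu) valuation1). Qed.

(* In Newton polygon terms: the line of slope [- y] supporting the polygon of
   [p] from below has height [W] at 0, and [d] is the last index it touches. *)
Definition dominant_coef (p : {poly K}) (y W : R) (d : nat) : Prop :=
  [/\ forall k, (W - y *+ k)%:E <= nu p`_k,
      nu p`_d = (W - y *+ d)%:E &
      forall k, (d < k)%N -> (W - y *+ k)%:E < nu p`_k].

Lemma dominant_coef1 (y : R) : dominant_coef 1%R y 0%R 0.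
Proof.
split=> [k||[|k] //]; rewrite coef1 /= ?valuation1 ?valuation0 ?ltry ?subr0 //.
by case: k => [|k]; rewrite /= ?valuation1 ?valuation0 ?leey ?subr0.
Qed.

(** The k-th coefficient of the product is [p]_(k-1) - a * p[_k]. The first terms lie above the line
    of height [W + y] and touch it last at [d.+1]; the second ones lie above the line of height
    [W + nu a] and touch it last at [d]. The lower of the two lines supports the product. *)
Lemma dominant_coefMXsubC (p : {poly K}) (y W : R) d (a : K) :
  dominant_coef p y W d ->
  exists2 e, mine y%:E (nu a) = e%:E & exists2 d', (d' <= d.+1)%N &
    dominant_coef (p * ('X - a%:P))%R y (W + e)%R d'.
Proof.
move=> [geW eqW gtW].
have coefE k : ((p * ('X - a%:P))`_k =
    - (a * p`_k) + (if k == 0%N then 0 else p`_k.-1))%R.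
  by rewrite mulrBr coefB coefMX coefMC addrC mulrC.
have shift k : (W + y - y *+ k.+1 = W - y *+ k)%R.
  by rewrite mulrS opprD addrA addrK.
have geX k : (W + y - y *+ k)%:E <= nu (if k == 0%N then 0 else p`_k.-1)%R.
  by case: k => [|k]; rewrite /= ?valuation0 ?leey // shift.
have gtX k : (d.+1 < k)%N ->
    (W + y - y *+ k)%:E < nu (if k == 0%N then 0 else p`_k.-1)%R.
  by case: k => [|k] //= dk; rewrite shift; apply: gtW.
have geA k e : e%:E <= nu a -> (W + e - y *+ k)%:E <= nu (- (a * p`_k))%R.
  move=> ea; rewrite valuationN (valuationM hnu) addrAC addrC EFinD.
  exact: leeD.
have gtA k e : e%:E <= nu a -> (d < k)%N ->
    (W + e - y *+ k)%:E < nu (- (a * p`_k))%R.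
  move=> ea dk; rewrite valuationN (valuationM hnu) addrAC addrC EFinD.
  have := gtW _ dk; case: (nu a) ea => [r| |] // ea lt_p; last first.
    by rewrite addye ?valuation_neqNy // -EFinD ltry.
  by rewrite lee_ltD.
have [ya|ay] := leP y%:E (nu a).
  exists y => //; exists d.+1 => //; split=> [k||k dk]; rewrite coefE.
  - exact: valuation_ge_add (geA _ _ ya) (geX _).
  - rewrite addrC valuation_eq_add /= eqW ?shift // -shift.
    exact: gtA.
  - by apply: valuation_gt_add (gtX _ dk); apply: gtA => //; exact: ltnW.
have : nu a \is a fin_num.
  by rewrite fin_numE valuation_neqNy lt_eqF // (lt_trans ay) ?ltry.
case nua : (nu a) ay => [e| |] // ; rewrite lte_fin => ey _.
have lt_ey k : ((W + e - y *+ k)%:E < (W + y - y *+ k)%:E).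
  by rewrite lte_fin ltrD2r ltrD2l.
have ea : e%:E <= nu a by rewrite nua.
exists e => //; exists d => //; split=> [k||k dk]; rewrite coefE.
- by apply: valuation_ge_add (geA _ _ ea) (le_trans (ltW (lt_ey k)) (geX _)).
- have nuad : nu (- (a * p`_d))%R = (W + e - y *+ d)%:E.
    by rewrite valuationN (valuationM hnu) eqW nua -EFinD addrCA addrA.
  by rewrite valuation_eq_add nuad //; exact: lt_le_trans (lt_ey d) (geX _).
- by apply: valuation_gt_add (gtA _ _ ea dk) (lt_le_trans (lt_ey k) (geX _)).
Qed.

(** Each linear factor raises the height by [mine y%:E (nu x)], starting from height 0 for the
    polynomial 1. The bound on [d] later makes it an index of the characteristic polynomial. *)
Lemma prod_XsubC_dominant_coef (l : seq K) (y : R) :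
  exists2 W, \sum_(x <- l) mine y%:E (nu x) = W%:E &
    exists2 d, (d <= size l)%N &
      dominant_coef (\prod_(x <- l) ('X - x%:P))%R y W d.
Proof.
elim: l => [|a l [W sumE [d dl dom]]].
  exists 0%R; rewrite ?big_nil //; exists 0%N => //.
  exact: dominant_coef1.
have [e eE [d' d'd dom']] := dominant_coefMXsubC a dom.
exists (W + e)%R; first by rewrite big_cons sumE eE -EFinD addrC.
by exists d'; [exact: leq_trans d'd _ | rewrite big_cons mulrC].
Qed.

Lemma mp_char_poly_le_valuation n (A : 'M[K]_n) (k : 'I_n.+1) :
  mp_char_poly (map_mx nu A) k <= nu (char_poly A)`_k.
Proof.
rewrite /mp_char_poly; case: eqP => [->|_].
  have /monicP := char_poly_monic A.
  by rewrite /lead_coef size_char_poly /= => ->; rewrite valuation1.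
rewrite /char_poly /determinant coef_sum; apply: valuation_ge_sum => s _.
set q := (X in (_ * X)%R); rewrite mulr_sign.
suff : \big[mine/+oo]_(J : {set 'I_n} | #|J| == (n - k)%N)
    \big[mine/+oo]_(s : {perm 'I_n} | perm_on J s)
      \sum_(j in J) map_mx nu A j (s j) <= nu q`_k.
  by case: odd_perm; rewrite // coefN valuationN.
have -> : q = (\prod_i (- (A i (s i))%:P + 'X *+ (i == s i)))%R.
  by apply: eq_bigr => i _; rewrite !mxE addrC.
(* [J] is the set of rows in which the constant entry is chosen; the other rows contribute their
   diagonal ['X]. *)
rewrite bigA_distr coef_sum; apply: valuation_ge_sum => J _.
(* If [s] moves a point outside [J], the ['X] chosen there is off the diagonal and the product
   vanishes. *)
have [sJ|] := boolP (perm_on J s); last first.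
  case/subsetPn => i; rewrite inE => si iJ.
  suff -> : (\prod_i (if i \in J then - (A i (s i))%:P
                      else 'X *+ (i == s i)) = 0)%R.
    by rewrite coef0 valuation0 leey.
  by apply/eqP/prodf_eq0; exists i => //; rewrite (negPf iJ) [i == _]eq_sym (negPf si).
rewrite big_if /=.
have -> : (\prod_(i in J) - (A i (s i))%:P = (\prod_(i in J) - A i (s i))%:P)%R.
  by rewrite rmorph_prod; apply: eq_bigr => i _; rewrite rmorphN.
have -> : (\prod_(i | i \notin J) ('X *+ (i == s i)) = 'X^(n - #|J|) :> {poly K})%R.
  rewrite (eq_bigr (fun=> 'X%R)) => [|i iJ].
    rewrite prodr_const; congr ('X^_)%R.
    by have := cardC J; rewrite card_ord => /(canRL (addKn _)).
  by rewrite (out_perm sJ) // eqxx.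
rewrite coefCM coefXn; case: eqP => [kE|_]; last first.
  by rewrite mulr0 valuation0 leey.
have Jn : (#|J| <= n)%N by rewrite -[n in (_ <= n)%N]card_ord max_card.
rewrite mulr1; apply: (bigmin_inf J); first by rewrite kE subKn.
apply: (bigmin_inf s) => //; rewrite valuation_prod.
by apply: lee_sum => i _; rewrite mxE valuationN.
Qed.

(** The minimum [mp_eval] is at most its term at the contact index [d], where the valuation of the
    coefficient plus [y *+ d] is exactly the height [W]. *)
Lemma mp_char_poly_eval_le n (A : 'M[K]_n) (l : n.-tuple K) (y : R) :
  char_poly A = (\prod_(x <- l) ('X - x%:P))%R ->
  mp_eval (mp_char_poly (map_mx nu A)) y%:E <= \sum_(x <- l) mine y%:E (nu x).
Proof.
move=> charE; have [W -> [d]] := prod_XsubC_dominant_coef l y.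
rewrite size_tuple -ltnS -charE => dn [_ nuE _].
apply: (bigmin_inf (Ordinal dn)) => //.
have /= := mp_char_poly_le_valuation A (Ordinal dn); rewrite nuE => le_W.
rewrite -EFin_natmul.
by apply: le_trans (leeD2r _ le_W) _; rewrite -EFinD subrK.
Qed.

End Valuation.

(** * From truncated sums to partial sums *)

Section Majorization.
Set Implicit Arguments.
Unset Strict Implicit.
Context {R : realType}.
Implicit Types (s u v : seq (\bar R)) (M : R).

Lemma sum_min_fin_num s M :
  all (@in_Rmin R) s -> \sum_(x <- s) mine M%:E x \is a fin_num.
Proof.
elim: s => [|x s IH] /=; first by rewrite big_nil.
case/andP=> x_Rmin /IH; rewrite big_cons fin_numD => ->; rewrite andbT.
by case: x x_Rmin => [r| |] // _; case: leP => //; rewrite leNgt ltry.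
Qed.

(** This is the passage to the limit as M tends to +oo. An infinite entry is impossible, because its
    truncation M alone would make the sums unbounded. *)
Lemma le_sum_of_truncations s (V : R) :
  all (@in_Rmin R) s ->
  (forall M, \sum_(x <- s) mine M%:E x <= V%:E) -> \sum_(x <- s) x <= V%:E.
Proof.
elim: s V => [|x s IH] V; first by move=> _ /(_ 0%R); rewrite !big_nil.
have sum_mono M N : (M <= N)%R ->
    \sum_(z <- s) mine M%:E z <= \sum_(z <- s) mine N%:E z.
  by move=> MN; apply: lee_sum => z _; apply: le_min2.
case/andP; case: x => [r| |] // _ s_Rmin le_V.
  rewrite big_cons addeC -leeBrDr // -EFinB; apply: IH => // M.
  (* Truncating at [Num.max M r] leaves the head [r] intact, so it can be subtracted exactly. *)
  have /sum_mono /le_trans : (M <= Num.max M r)%R by rewrite le_max lexx.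
  apply; rewrite EFinB leeBrDr // addeC.
  apply: le_trans (le_V (Num.max M r)).
  by rewrite big_cons min_r // lee_fin le_max lexx orbT.
exfalso; have /fineK sum0 := sum_min_fin_num 0%R s_Rmin.
(* [S] bounds the truncated tail from below for every M >= 0, and this [M] makes [M + S] exceed
   [V]. *)
set S := fine _ in sum0; pose M := Num.max 0%R (V - S + 1)%R.
have /sum_mono : (0 <= M)%R by rewrite le_max lexx.
rewrite -sum0 => S_le; have := le_V M.
rewrite big_cons min_l ?leey // => /(le_trans (leeD2l M%:E S_le)).
rewrite -EFinD lee_fin leNgt => /negP; apply.
by rewrite -ltrBlDr lt_max ltrDl ltr01 orbT.
Qed.

Lemma weak_majorization_of_truncations u v k :
  size u = size v -> all (@in_Rmin R) u -> all (@in_Rmin R) v ->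
  sorted <=%O u ->
  (forall y : R, \sum_(x <- u) mine y%:E x <= \sum_(x <- v) mine y%:E x) ->
  (1 <= k <= size u)%N ->
  \sum_(x <- take k u) x <= \sum_(x <- take k v) x.
Proof.
move=> uv u_Rmin v_Rmin u_sorted le_uv /andP[k_gt0 ku].
have take_Rmin w : all (@in_Rmin R) w -> all (@in_Rmin R) (take k w).
  by move=> /allP w_Rmin; apply/allP => x /mem_take /w_Rmin.
case VE : (\sum_(x <- take k v) x) => [V| |]; last first.
- have : all (@in_Rmin R) (take k v) by exact: take_Rmin.
  move: VE; elim: (take k v) => [|x w IH]; first by rewrite big_nil.
  rewrite big_cons => /eqP; rewrite adde_eq_ninfty => /orP[/eqP -> //|/eqP sumE].
  by case/andP=> _; exact: IH.
- exact: leey.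
(* Testing at [min(M, u_k)], rather than at [u_k], keeps [y] real when [u_k] is
   infinite. *)
apply: le_sum_of_truncations => [|M]; first exact: take_Rmin.
pose z := nth 0 u k.-1.
have k1u : (k.-1 < size u)%N by rewrite prednK.
have [y yE] : exists y : R, y%:E = mine M%:E z.
  have : in_Rmin z by apply: (allP u_Rmin); exact: mem_nth.
  case: z => [r| |] // _; last by exists M; rewrite min_l ?leey.
  by exists (Num.min M r); rewrite EFin_min.
have take_le x : x \in take k u -> x <= z.
  case/(nthP 0) => i; rewrite size_takel // => ik <-; rewrite nth_take //.
  apply: (sorted_leq_nth le_trans le_refl) => //; rewrite ?inE.
    exact: leq_trans ik ku.
  by rewrite -ltnS prednK.
have drop_ge x : x \in drop k u -> z <= x.
  case/(nthP 0) => i; rewrite size_drop => ik <-; rewrite nth_drop.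
  apply: (sorted_leq_nth le_trans le_refl) => //; rewrite ?inE.
    by rewrite -ltn_subRL.
  by rewrite (leq_trans (leq_pred k)) // leq_addr.
(* As y = min(M, z), with z the k-th entry of [u], truncation at y acts as truncation at M on the
   first k entries, and sends all later ones to y. *)
have uE : \sum_(x <- u) mine y%:E x =
    \sum_(x <- take k u) mine M%:E x + (y *+ (size u - k))%:E.
  rewrite -[in LHS](cat_take_drop k u) big_cat /=; congr (_ + _).
    by apply: eq_big_seq => x /take_le xz; rewrite yE -minA [mine z x]min_r.
  rewrite (eq_big_seq (fun=> y%:E)) => [|x /drop_ge zx]; last first.
    by rewrite min_l // yE ge_min zx orbT.
  by rewrite sumEFin big_const_seq iter_addr_0 count_predT size_drop.
have := le_uv y; rewrite uE => /le_trans le_v.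
rewrite -(@leeD2rE _ (y *+ (size u - k))%:E) //; apply: le_v.
(* On the side of [v], each truncation is bounded by x itself for the first k entries and by y for
   the others, which gives the same finite term [y *+ (size u - k)]. *)
rewrite -[in leLHS](cat_take_drop k v) big_cat /= -VE uv; apply: leeD.
  by apply: lee_sum => x _; rewrite ge_min lexx orbT.
apply: (@le_trans _ _ (\sum_(x <- drop k v) y%:E)).
  by apply: lee_sum => x _; rewrite ge_min lexx.
by rewrite sumEFin big_const_seq iter_addr_0 count_predT size_drop.
Qed.

End Majorization.

Theorem theorem4p4 (R : realType) (K : closedFieldType) (nu : K -> \bar R)
    (hnu : is_valuation nu) (n : nat) (A : 'M[K]_n)
    (l : n.-tuple K) (hl : eigenvalues_mult A l)
    (c : n.-tuple (\bar R)) (hc : mp_alg_eigenvalues (map_mx nu A) c) :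
  weakly_super_majorized (map_tuple nu l) c.
Proof.
case: hc => _ cRmin csort evalE k kn.
rewrite (sorted_sort le_trans csort).
apply: weak_majorization_of_truncations => //.
- by rewrite size_sort !size_tuple.
- rewrite all_sort; apply/allP => _ /mapP[x _ ->]; exact: valuation_Rmin.
- move=> y; have := mp_char_poly_eval_le hnu y hl.
  rewrite evalE // /mp_char_poly eqxx add0e.
  rewrite -(big_tuple _ _ c xpredT (fun x => mine y%:E x)) => /le_trans; apply.
  rewrite [leRHS](perm_big _ (permEl (perm_sort _ _))) /= big_map.
  exact: lexx.
- by rewrite size_tuple.
Qed.
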